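(* Consider the soft-core Widom-Rowlinson model on the Cayley tree of order $d$, and let $\beta>0$. Then there exists $\lambda_g(\beta,d)\in(0,\infty)$ such that for every $0<\lambda<\lambda_g(\beta,d)$ the time-evolved intermediate measure $\mu^{\#}_{\beta,\lambda,t}$ is almost surely Gibbs for every time $t>0$, i.e. the set of bad configurations for $\mu^{\#}_{\beta,\lambda,t}$ has $\mu^{\#}_{\beta,\lambda,t}$-measure zero.
   Context: The Cayley tree of order $d$ is the infinite tree $(V,E)$ in which each vertex has exactly $d+1$ neighbours. $\Omega=\{-1,0,1\}^V$ carries the product $\sigma$-algebra and product topology; $\sigma_\Lambda$ denotes the restriction map $\omega\mapsto\omega_\Lambda=(\omega_i)_{i\in\Lambda}$, $\mathcal F_\Lambda$ the $\sigma$-algebra generated by $\sigma_\Lambda$, and $\Lambda\Subset V$ means $\Lambda$ is a finite subset. A function is local if it is $\mathcal F_\Lambda$-measurable for some $\Lambda\Subset V$. Soft-core Widom-Rowlinson model (zero magnetic field), $\beta>0$ (repulsion), $\lambda>0$ (activity): for $\Lambda\Subset V$, $$\gamma_\Lambda(\sigma_\Lambda=\omega_\Lambda\mid\eta_{\Lambda^c})=\frac1{Z_\Lambda(\eta_{\Lambda^c})}\exp\Big(-\beta\sum_{\{i,j\}\in E,\{i,j\}\cap\Lambda\ne\emptyset}1_{\{\tilde\omega_i\tilde\omega_j=-1\}}\Big)\prod_{i\in\Lambda}\lambda^{\omega_i^2},\qquad \tilde\omega=\omega_\Lambda\eta_{\Lambda^c}.$$ Gibbs measures of the model are probability measures $\mu$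 with $\mu=\mu\gamma_\Lambda$ for all $\Lambda\Subset V$. A probability measure $\mu$ on $\Omega$ is a tree-indexed Markov chain if for each oriented edge $ij$ one has $\mu(\sigma_j=x\mid\mathcal F_{(-\infty,ij)})=\mu(\sigma_j=x\mid\mathcal F_{\{i\}})$ $\mu$-a.s. for all $x$, where $(-\infty,ij)$ is the set of vertices $k$ whose self-avoiding path to $i$ does not contain $j$. The intermediate measure $\mu^{\#}_{\beta,\lambda}$ is the unique Gibbs measure of the model that is a tree-indexed Markov chain, invariant under all tree automorphisms, and invariant under the spin flip $\omega\mapsto-\omega$. Concretely, let $\xi=\xi_{\beta,\lambda}$ be the unique positive solution of $x=\lambda\big(\frac{1+(1+e^{-\beta})x}{1+2x}\big)^d$; then $\mu^{\#}_{\beta,\lambda}$ is the homogeneous tree-indexed Markov chain with transition matrix $P$ given by $P(s,s)=\frac{\xi}{1+(1+e^{-\beta})\xi}$, $P(s,-s)=\frac{e^{-\beta}\xi}{1+(1+e^{-\beta})\xi}$, $P(s,0)=\frac{1}{1+(1+e^{-\beta})\xi}$ for $s\in\{-1,1\}$, $P(0,\pm1)=\frac{\xi}{1+2\xi}$, $P(0,0)=\frac1{1+2\xi}$, with the $P$-invariant distribution as single-site marginal. Time evolution: for $t\ge0$, $\mu_t$ is the image of $\mu$ under the product kernel that acts independently at each site by $$p_t(\omega,\eta)=\tfrac12(1+e^{-2t})1_{\{\omega=\eta\ne0\}}+\tfrac12(1-e^{-2t})1_{\{\omega\eta=-1\}}+1_{\{\omega=\eta=0\}},\qquad \omega,\eta\in\{-1,0,1\}.$$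 $\mu^{\#}_{\beta,\lambda,t}$ is the time-evolved measure started from $\mu^{\#}_{\beta,\lambda}$. Bad configurations: $\eta\in\Omega$ is bad for $\mu_t$ if there exist a local function $f$ and $\Lambda_0\Subset V$ such that $$\limsup_{\Lambda\nearrow V}\ \sup_{\xi^1,\xi^2\in\Omega,\ \Delta:\Lambda\subset\Delta\Subset V}\big|\mu_t(f\mid\eta_{\Lambda\setminus\Lambda_0}\xi^1_{\Delta\setminus\Lambda})-\mu_t(f\mid\eta_{\Lambda\setminus\Lambda_0}\xi^2_{\Delta\setminus\Lambda})\big|>0,$$ where $\mu_t(f\mid\zeta_A)$ is the elementary conditional expectation of $f$ given $\{\sigma_A=\zeta_A\}$ and the limsup is along finite $\Lambda$ directed by inclusion. *)

(* Defs.v *)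
From HB Require Import structures.
From mathcomp Require Import all_boot all_order all_algebra finmap.
From mathcomp Require Import all_classical all_reals all_analysis.

Set Implicit Arguments.
Unset Strict Implicit.
Unset Printing Implicit Defensive.

Import Order.TTheory GRing.Theory Num.Theory.

Local Open Scope classical_set_scope.
Local Open Scope ring_scope.

Section Tree.
Context {V : choiceType}.
Implicit Types (E : rel V) (i j k : V).

Definition connected_graph E :=
  forall i j, exists2 p, path E i p & last i p = j.

(* [ucycle] also accepts an edge traversed back and forth, of size 2. *)
Definition acyclic_graph E := forall c, ucycle E c -> (size c < 3)%N.

Definition cayley_tree (d : nat) E :=
  [/\ symmetric E /\ irreflexive E,
      connected_graph E,
      acyclic_graph E,
      forall i, ([set j | E i j] #= `I_d.+1)%card &
      infinite_set [set: V]].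

(* The past (-oo, ij) of the oriented edge ij. *)
Definition past E i j : set V :=
  [set k | exists p, [/\ path E k p, last k p = i, uniq (k :: p)
                       & j \notin k :: p]].

Definition tree_automorphism E (phi : V -> V) :=
  bijective phi /\ {mono phi : i j / E i j}.

Definition edges_touching E (L : {fset V}) : set {fset V} :=
  [set e | exists i j, [/\ E i j, e = [fset i; j]%fset
                         & (i \in L) || (j \in L)]].

End Tree.

Inductive spin := Neg | Hole | Pos.

Definition spin_code (s : spin) : option bool :=
  match s with Neg => Some false | Hole => None | Pos => Some true end.
Definition spin_decode (o : option bool) : spin :=
  match o with Some false => Neg | None => Hole | Some true => Pos end.
Lemma spin_codeK : cancel spin_code spin_decode. Proof. by case. Qed.

HB.instance Definition _ := Finite.copy spin (can_type spin_codeK).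
HB.instance Definition _ := isPointed.Build spin Hole.

Definition spin_val (s : spin) : int :=
  match s with Neg => -1 | Hole => 0 | Pos => 1 end.
Coercion spin_val : spin >-> int.

Definition spin_opp (s : spin) : spin :=
  match s with Neg => Pos | Hole => Hole | Pos => Neg end.

Definition site_events {V : choiceType} (D : set V) : set (set (V -> spin)) :=
  [set A | exists i s, D i /\ A = [set w | w i = s]].

(* {-1,0,1}^V with its product sigma-algebra. *)
Definition Omega (V : choiceType) := g_sigma_algebraType (@site_events V setT).
HB.instance Definition _ (V : choiceType) := Measurable.on (Omega V).

Section Configurations.
Context {V : choiceType}.

(* The sigma-algebra generated by the restriction map to D. *)
Definition sigma_at (D : set V) : set (set (Omega V)) := <<s site_events D >>.

Definition cylinder (D : {fset V}) (zeta : Omega V) : set (Omega V) :=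
  [set w | forall i, i \in D -> w i = zeta i].

Definition splice (L : {fset V}) (a : {ffun L -> spin}) (eta : Omega V) :
    Omega V :=
  fun i => if insub i is Some j then a j else eta i.

Definition patch_conf (L : {fset V}) (eta xi : Omega V) : Omega V :=
  fun i => if i \in L then eta i else xi i.

End Configurations.

Section WidomRowlinson.
Context {R : realType} {V : choiceType}.
Variables (E : rel V) (beta lambda : R).

(* An edge e = {i, j} such that w_i w_j = -1; the degenerate pairs (i, i)
   contribute nothing because w_i ^ 2 is nonnegative. *)
Definition repelling (w : Omega V) (e : {fset V}) : bool :=
  [exists i : e, [exists j : e,
     (w (val i) : int) * (w (val j) : int) == -1 :> int]].

Definition boltzmann (L : {fset V}) (w : Omega V) : R :=
  expR (- beta * \sum_(e \in edges_touching E L) ((repelling w e)%:R : R))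
  * \prod_(i <- L) lambda ^ ((w i : int) ^+ 2).

Definition partition_function (L : {fset V}) (eta : Omega V) : R :=
  \sum_(a : {ffun L -> spin}) boltzmann L (splice a eta).

Definition specification (L : {fset V}) (A : set (Omega V)) (eta : Omega V) :
    R :=
  (\sum_(a : {ffun L -> spin}) boltzmann L (splice a eta) * \1_A (splice a eta))
  / partition_function L eta.

Definition gibbs_measure (mu : probability (Omega V) R) :=
  forall (L : {fset V}) (A : set (Omega V)), measurable A ->
    mu A = (\int[mu]_eta (specification L A eta)%:E)%E.

End WidomRowlinson.

Section Measures.
Context {R : realType} {V : choiceType}.
Implicit Types (E : rel V) (mu nu : probability (Omega V) R).

Definition measurable_wrt (G : set (set (Omega V))) (f : Omega V -> R) :=
  forall B : set R, measurable B -> G (f @^-1` B).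

(* g is a version of the conditional probability mu(A | G). *)
Definition cond_prob mu (G : set (set (Omega V))) (A : set (Omega V))
    (g : Omega V -> R) :=
  [/\ measurable_wrt G g,
      mu.-integrable setT (EFin \o g) &
      forall B, G B -> (\int[mu]_(w in B) (g w)%:E = mu (A `&` B))%E].

Definition tree_markov_chain E mu :=
  forall i j (x : spin) (g h : Omega V -> R), E i j ->
    cond_prob mu (sigma_at (past E i j)) [set w | w j = x] g ->
    cond_prob mu (sigma_at [set i]) [set w | w j = x] h ->
    {ae mu, forall w, g w = h w}.

Definition automorphism_invariant E mu :=
  forall phi, tree_automorphism E phi ->
  forall A : set (Omega V), measurable A ->
    mu [set w : Omega V | A (w \o phi)] = mu A.

Definition flip_invariant mu :=
  forall A : set (Omega V), measurable A ->
    mu [set w : Omega V | A (spin_opp \o w)] = mu A.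

Definition intermediate_measure E (beta lambda : R) mu :=
  [/\ gibbs_measure E beta lambda mu,
      tree_markov_chain E mu,
      automorphism_invariant E mu &
      flip_invariant mu].

Definition site_transition (t : R) (s s' : spin) : R :=
  2^-1 * (1 + expR (- 2 * t)) * ((s == s') && (s != Hole))%:R
  + 2^-1 * (1 - expR (- 2 * t)) * ((s : int) * (s' : int) == -1 :> int)%:R
  + ((s == s') && (s == Hole))%:R.

(* K is the kernel acting independently at each site by [site_transition t];
   it is determined by its values on cylinders. *)
Definition product_kernel (t : R) (K : R.-pker (Omega V) ~> (Omega V)) :=
  forall (w zeta : Omega V) (D : {fset V}),
    K w (cylinder D zeta) = (\prod_(i <- D) site_transition t (w i) (zeta i))%:E.

Definition time_evolved (t : R) mu nu :=
  exists2 K : R.-pker (Omega V) ~> (Omega V), product_kernel t K &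
    forall A, measurable A -> nu A = (\int[mu]_w K w A)%E.

Definition local_function (f : Omega V -> R) :=
  exists L : {fset V}, measurable_wrt (sigma_at [set` L]) f.

(* The elementary conditional expectation nu(f | zeta_D). *)
Definition cond_expectation nu (f : Omega V -> R) (D : {fset V})
    (zeta : Omega V) : R :=
  (\int[nu]_(w in cylinder D zeta) f w) / fine (nu (cylinder D zeta)).

Definition finite_volume_expectation nu (f : Omega V -> R)
    (L0 L D : {fset V}) (eta xi : Omega V) : R :=
  cond_expectation nu f ((L `\` L0) `|` (D `\` L))%fset (patch_conf L eta xi).

Definition oscillation nu (f : Omega V -> R) (L0 : {fset V}) (eta : Omega V)
    (L : {fset V}) : \bar R :=
  ereal_sup [set r | exists xi1 xi2 D, (L `<=` D)%fset /\
    r = `|finite_volume_expectation nu f L0 L D eta xi1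
          - finite_volume_expectation nu f L0 L D eta xi2|%:E].

(* limsup along the finite sets directed by inclusion. *)
Definition fset_limsup (u : {fset V} -> \bar R) : \bar R :=
  ereal_inf [set ereal_sup [set u L | L in [set L | (L1 `<=` L)%fset]]
            | L1 in [set: {fset V}]].

Definition bad_configuration nu (eta : Omega V) :=
  exists f L0, local_function f /\
    (0 < fset_limsup (oscillation nu f L0 eta))%E.

Definition almost_surely_gibbs nu := nu.-negligible (bad_configuration nu).

End Measures.

(* Main.v *)
(* A site is empty at time t if and only if it is empty at time 0, since spins
   flip independently and never touch the holes.  By the DLR equation every
   Gibbs measure gives probability at most (2 lambda)^|S| to the event that a
   finite set S is fully occupied, whatever the boundary condition.  There are
   at most (d+1)^n self-avoiding walks of length n from a vertex, so for
   lambda < 1/(4(d+1)) almost surely no vertex lies in an infinite cluster of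
   occupied sites.
   If all clusters of eta are finite, every finite set is contained in a finite
   W all of whose outer boundary sites are holes of eta.  The holes decouple W
   from the rest of the tree: nu(cylinder on W and D) is a weight depending on
   W only times nu(cylinder on D).  The second factor, which is positive, cancels
   in the elementary conditional expectation of a function of the spins in W,
   so that this expectation does not see the configuration outside W and eta is
   not bad. *)

Require Import Defs.
From mathcomp Require Import all_boot all_order all_algebra finmap.
From mathcomp Require Import all_classical all_reals all_analysis measurable_realfun.

Set Implicit Arguments.
Unset Strict Implicit.
Unset Printing Implicit Defensive.

Import Order.TTheory GRing.Theory Num.Theory.
Local Open Scope classical_set_scope.
Local Open Scope ring_scope.

(** * Events depending on finitely many sites *)

Section LocalEvents.
Context {V : choiceType}.
Implicit Types (S W D : {fset V}) (w z : Omega V).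

(** Filler outside a finite set, turning a spin pattern on [S] into a full configuration; later also
    the boundary condition of holes. *)
Definition holes : Omega V := fun=> Hole.

Definition agree S w z := forall i, i \in S -> w i = z i.

Definition restrict S w : {ffun S -> spin} := [ffun i => w (val i)].

Lemma spliceE {S} (a : {ffun S -> spin}) z i (iS : i \in S) :
  splice a z i = a [` iS]%fset.
Proof. by rewrite /splice insubT. Qed.

Lemma splice_val {S} (a : {ffun S -> spin}) z (i : S) :
  splice a z (val i) = a i.
Proof. by rewrite /splice valK. Qed.

Lemma splice_out {S} (a : {ffun S -> spin}) z i : i \notin S ->
  splice a z i = z i.
Proof. by move=> iS; rewrite /splice insubN. Qed.

Lemma splice_restrict S w z : agree S w (splice (restrict S w) z).
Proof. by move=> i iS; rewrite spliceE ffunE. Qed.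

Lemma splice_agree S w z (a : {ffun S -> spin}) :
  agree S w (splice a z) -> a = restrict S w.
Proof.
by move=> h; apply/ffunP => -[i iS]; rewrite ffunE/= h// spliceE.
Qed.

Lemma measurable_cylinder S z : measurable (cylinder S z).
Proof.
rewrite (_ : cylinder S z = \bigcap_(i in [set` S]) [set w | w i = z i]).
  apply: fin_bigcap_measurable => // i _.
  by apply: sub_sigma_algebra; exists i, (z i).
by apply/seteqP; split => w /= h i; exact: h.
Qed.

(** There are finitely many spin patterns on [S], so such an event is a finite union of
    cylinders. *)
Lemma measurable_local (A : set (Omega V)) S :
  (forall w z, agree S w z -> A w -> A z) -> measurable A.
Proof.
move=> loc.
rewrite (_ : A = \bigcup_(a in [set a : {ffun S -> spin} | A (splice a holes)])
  cylinder S (splice a holes)).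
  by apply: fin_bigcup_measurable => // a _; exact: measurable_cylinder.
apply/seteqP; split => w /=.
  move=> Aw; exists (restrict S w); last exact: splice_restrict.
  by apply: loc Aw; exact: splice_restrict.
by case=> a /= Aa wa; apply: loc Aa => i iS; rewrite wa.
Qed.

Lemma measurable_fun_local d (T : measurableType d) (f : Omega V -> T) S :
  (forall w z, agree S w z -> f w = f z) -> measurable_fun [set: Omega V] f.
Proof.
move=> loc _ B _; rewrite setTI; apply: (@measurable_local _ S) => w z wz /=.
by rewrite (loc _ _ wz).
Qed.

(** The events that do not distinguish configurations agreeing on [S] form a sigma-algebra
    containing the site events of [S]. *)
Lemma sigma_at_local S A : sigma_at [set` S] A ->
  forall w z, agree S w z -> A w -> A z.
Proof.
suff: sigma_at [set` S] `<=` [set A | forall w z, agree S w z -> A w <-> A z].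
  by move=> h sA w z wz; case: (h A sA w z wz).
apply: smallest_sub.
  split => //= [B /= HB w z wz|F HF w z wz].
    by rewrite /setD/=; split=> -[_ h]; split=> // /(HB _ _ wz).
  by split=> -[n _ Fn]; exists n => //; apply/(HF n _ _ wz).
by move=> B [i [s [iS ->]]] w z wz /=; rewrite wz.
Qed.

Lemma measurable_wrt_local (R : realType) S (f : Omega V -> R) :
  measurable_wrt (sigma_at [set` S]) f ->
  forall w z, agree S w z -> f w = f z.
Proof.
move=> mf w z wz; apply/esym.
exact: (sigma_at_local (mf [set f w] (measurable_set1 _)) wz).
Qed.

(** * Splitting events and integrals along the spin patterns on a finite set *)

Lemma bigsetU_cylinder (B : set (Omega V)) S :
  \big[setU/set0]_(a : {ffun S -> spin}) (B `&` cylinder S (splice a holes)) = B.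
Proof.
rewrite -big_distrr/=.
apply/seteqP; split=> [w []//|w Bw]; split => //.
rewrite -bigcup_seq; exists (restrict S w) => /=; first by rewrite mem_index_enum.
exact: splice_restrict.
Qed.

Lemma trivIset_cylinder (B : set (Omega V)) S (D : set {ffun S -> spin}) :
  trivIset D (fun a => B `&` cylinder S (splice a holes)).
Proof.
move=> a b _ _ [w [[_ wa] [_ wb]]].
by rewrite (splice_agree wa) (splice_agree wb).
Qed.

Section Integrals.
Context {R : realType}.
Implicit Type mu : probability (Omega V) R.

Lemma ge0_integral_cylinder mu (B : set (Omega V)) S (f : Omega V -> \bar R) :
  measurable B -> measurable_fun [set: Omega V] f -> (forall w, 0 <= f w)%E ->
  (\int[mu]_(w in B) f w =
   \sum_(a : {ffun S -> spin})
     \int[mu]_(w in B `&` cylinder S (splice a holes)) f w)%E.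
Proof.
move=> mB mf f0; rewrite -{1}(bigsetU_cylinder B S).
rewrite ge0_integral_bigsetU//.
- by move=> a; apply: measurableI => //; exact: measurable_cylinder.
- exact: index_enum_uniq.
- exact: trivIset_cylinder.
- by rewrite bigsetU_cylinder; exact: measurable_funTS.
Qed.

Lemma integral_cylinder mu (B : set (Omega V)) S (f : Omega V -> R) :
  measurable B -> measurable_fun [set: Omega V] f ->
  (\int[mu]_(w in B) (f w)%:E =
   \sum_(a : {ffun S -> spin})
     \int[mu]_(w in B `&` cylinder S (splice a holes)) (f w)%:E)%E.
Proof.
move=> mB mf; rewrite -{1}(bigsetU_cylinder B S).
rewrite integral_bigsetU_EFin//.
- by move=> a; apply: measurableI => //; exact: measurable_cylinder.
- exact: index_enum_uniq.
- exact: trivIset_cylinder.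
- rewrite bigsetU_cylinder; apply/measurable_EFinP; exact: measurable_funTS.
Qed.

End Integrals.

End LocalEvents.

(** * Finite-volume Gibbs weights *)

Section Gibbs.
Context {R : realType} {V : choiceType}.
Variables (E : rel V) (N : V -> {fset V}) (beta lambda : R).
Hypothesis E_sym : symmetric E.
Hypothesis N_E : forall i j, (j \in N i) = E i j.
Hypothesis beta_ge0 : 0 <= beta.
Hypothesis lambda_gt0 : 0 < lambda.
Implicit Types (S L W D : {fset V}) (w z : Omega V) (mu : probability (Omega V) R).

Definition nbhd L : {fset V} := (L `|` \bigcup_(i <- L) N i)%fset.

Lemma nbhdP L i j : i \in L -> E i j -> j \in nbhd L.
Proof.
move=> iL Eij; rewrite in_fsetU; apply/orP; right.
by apply/bigfcupP; exists i; rewrite ?iL ?N_E.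
Qed.

Lemma sub_nbhd L i : i \in L -> i \in nbhd L.
Proof. by move=> iL; rewrite in_fsetU iL. Qed.

Lemma nbhd_inv L j : j \in nbhd L -> j \notin L -> exists2 i, i \in L & E i j.
Proof.
rewrite in_fsetU => /orP[->//|/bigfcupP[i /andP[iL _]]].
by rewrite N_E => Eij _; exists i.
Qed.

(** An edge touching [L] has both ends in [nbhd L]. *)
Lemma boltzmann_agree L w z : agree (nbhd L) w z ->
  boltzmann E beta lambda L w = boltzmann E beta lambda L z.
Proof.
move=> wz; rewrite /boltzmann; congr (expR (_ * _) * _).
  apply: eq_fsbigr => e; rewrite inE => -[i [j [Eij -> ij]]].
  suff h k : k \in [fset i; j]%fset -> w k = z k.
    congr (_%:R); rewrite /repelling.
    congr (nat_of_bool _); apply: eq_existsb => a; apply: eq_existsb => b.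
    by rewrite !h ?fsvalP.
  rewrite !inE => /orP[] /eqP ->; apply: wz.
    by case/orP: ij => [/sub_nbhd//|/nbhdP]; apply; rewrite E_sym.
  by case/orP: ij => [/nbhdP|/sub_nbhd//]; apply.
rewrite big_seq [RHS]big_seq; apply: eq_bigr => i iL.
by rewrite wz// sub_nbhd.
Qed.

Lemma boltzmann_gt0 L w : 0 < boltzmann E beta lambda L w.
Proof.
by rewrite mulr_gt0 ?expR_gt0// prodr_gt0// => i _; rewrite exprz_gt0.
Qed.

Lemma boltzmann_holes L w : (forall i, i \in L -> w i = Hole) ->
  boltzmann E beta lambda L w = 1.
Proof.
move=> wL; rewrite /boltzmann fsbig1 ?mulr0 ?expR0 ?mul1r.
  by rewrite big_seq big1// => i /wL ->.
move=> e [i [j [_ -> ij]]]; rewrite /repelling.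
case: existsP => // -[[a /= aij] /existsP[[b /= bij]]].
(* This settles the pairs in which both sites are the same end of the edge; in the other pairs one
   factor is a hole. *)
have sq s : ((s : spin) : int) * s == -1 = false by case: s.
by case/orP: ij => /wL wh; move: aij bij; rewrite !inE => /orP[] /eqP -> /orP[] /eqP ->;
  rewrite ?sq// wh/= ?mul0r ?mulr0.
Qed.

Lemma boltzmann_le L w :
  boltzmann E beta lambda L w <= \prod_(i <- L) lambda ^ ((w i : int) ^+ 2).
Proof.
rewrite ler_piMl//.
  by rewrite prodr_ge0// => i _; rewrite exprz_ge0// ltW.
by rewrite -expR0 ler_expR mulNr oppr_le0 mulr_ge0// fsumr_ge0.
Qed.

Lemma partition_function_ge L z (a : {ffun L -> spin}) :
  boltzmann E beta lambda L (splice a z) <= partition_function E beta lambda L z.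
Proof.
rewrite /partition_function (bigD1 a)//= lerDl sumr_ge0// => b _.
exact/ltW/boltzmann_gt0.
Qed.

(** The empty pattern on [L] alone contributes weight 1, whatever the boundary condition. *)
Lemma partition_function_ge1 L z : 1 <= partition_function E beta lambda L z.
Proof.
apply: le_trans (partition_function_ge z (restrict L (@holes V))).
by rewrite boltzmann_holes// => i iL; rewrite -splice_restrict.
Qed.

Lemma partition_function_gt0 L z : 0 < partition_function E beta lambda L z.
Proof. exact: lt_le_trans (partition_function_ge1 L z). Qed.

Lemma splice_agreeS L S (a : {ffun L -> spin}) w z :
  agree S w z -> agree S (splice a w) (splice a z).
Proof.
move=> wz i iS; have [iL|iL] := boolP (i \in L); first by rewrite !spliceE.
by rewrite !splice_out// wz.
Qed.

Lemma specification_agree L S (A : set (Omega V)) w z :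
  (forall w z, agree S w z -> A w -> A z) -> agree (nbhd L `|` S)%fset w z ->
  specification E beta lambda L A w = specification E beta lambda L A z.
Proof.
move=> loc wz.
have wzL (a : {ffun L -> spin}) : agree (nbhd L) (splice a w) (splice a z).
  by apply: splice_agreeS => i iL; rewrite wz// in_fsetU iL.
have wzS (a : {ffun L -> spin}) : agree S (splice a w) (splice a z).
  by apply: splice_agreeS => i iL; rewrite wz// in_fsetU iL orbT.
rewrite /specification; congr (_ / _); last first.
  by apply: eq_bigr => a _; exact: boltzmann_agree.
apply: eq_bigr => a _; rewrite (boltzmann_agree (wzL a)) !indicE.
congr (_ * (nat_of_bool _)%:R); apply/idP/idP; rewrite !inE.
  exact: loc.
by apply: loc => i iS; rewrite wzS.
Qed.

Lemma measurable_specification L S (A : set (Omega V)) :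
  (forall w z, agree S w z -> A w -> A z) ->
  measurable_fun [set: Omega V] (specification E beta lambda L A).
Proof.
move=> loc; apply: (@measurable_fun_local _ _ _ _ (nbhd L `|` S)%fset) => w z.
exact: specification_agree.
Qed.

Lemma specification_ge0 L A z : 0 <= specification E beta lambda L A z.
Proof.
rewrite divr_ge0 ?(ltW (partition_function_gt0 _ _))// sumr_ge0// => a _.
by rewrite mulr_ge0// ltW// boltzmann_gt0.
Qed.

(** * Probability that a finite set is fully occupied *)

Definition occupied S : set (Omega V) := [set w | forall i, i \in S -> w i != Hole].

Lemma occupied_local S w z : agree S w z -> occupied S w -> occupied S z.
Proof. by move=> wz oS i iS; rewrite -wz ?oS. Qed.

(** The partition function is at least 1, and each of the 2^|L| fully occupied patterns has weight
    at most lambda^|L|, since the repulsion only lowers weights. *)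
Lemma specification_occupied L z :
  specification E beta lambda L (occupied L) z <= (2 * lambda) ^+ #|` L|.
Proof.
rewrite ler_pdivrMr ?partition_function_gt0//.
have l2 : 0 <= 2 * lambda by rewrite mulr_ge0// ltW.
apply: (@le_trans _ _ ((2 * lambda) ^+ #|` L|)); last first.
  by rewrite ler_peMr ?exprn_ge0// partition_function_ge1.
(* With weight 0 on holes, the sum over all patterns factorizes into (0 + lambda + lambda)^|L|. *)
pose c (s : spin) : R := if s == Hole then 0 else lambda.
have -> : (2 * lambda) ^+ #|` L| = \sum_(a : {ffun L -> spin}) \prod_i c (a i).
  rewrite -(@bigA_distr_bigA _ _ _ _ _ L spin (fun=> c)) prodr_const -cardfE.
  congr (_ ^+ _); rewrite (bigD1 Hole)//= (bigD1 Neg)//= (bigD1 Pos)//= big1.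
    by rewrite /c/= addr0 add0r mulr_natl.
  by case.
apply: ler_sum => a _; rewrite indicE.
case: (boolP (splice a z \in occupied L)) => [|_]; last first.
  by rewrite mulr0 prodr_ge0// => i _; rewrite /c; case: ifP => // _; exact: ltW.
rewrite inE => oa; rewrite mulr1; apply: le_trans (boltzmann_le _ _) _.
rewrite big_seq_fsetE/=; apply: ler_prod => i _.
rewrite exprz_ge0 ?(ltW lambda_gt0)//=.
have := oa (val i) (valP i); rewrite splice_val /c => /negbTE ai; rewrite ai.
by case: (a i) ai.
Qed.

Lemma gibbs_occupied mu L : gibbs_measure E beta lambda mu ->
  (mu (occupied L) <= ((2 * lambda) ^+ #|` L|)%:E)%E.
Proof.
move=> gmu; rewrite (gmu L); last exact: measurable_local (@occupied_local L).
rewrite -[leRHS]mule1 -(@probability_setT _ _ _ mu) -integral_cst//.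
apply: ge0_le_integral => //=.
- by move=> z _; rewrite lee_fin specification_ge0.
- apply/measurable_EFinP; exact: measurable_specification (@occupied_local L).
- by move=> z _; rewrite lee_fin specification_occupied.
Qed.

(** * Positivity of cylinders and decoupling by holes *)

Lemma cylinder_local S z w w' : agree S w w' -> cylinder S z w -> cylinder S z w'.
Proof. by move=> ww wz i iS; rewrite -ww// wz. Qed.

(** By the DLR equation the probability is the integral of a function that is strictly positive
    everywhere; were it null, that function would vanish almost everywhere. *)
Lemma gibbs_cylinder_gt0 mu D z : gibbs_measure E beta lambda mu ->
  (0 < mu (cylinder D z))%E.
Proof.
move=> gmu; rewrite lt0e measure_ge0 andbT; apply/eqP => mu0.
have mf : measurable_fun [set: Omega V]
    (EFin \o specification E beta lambda D (cylinder D z)).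
  apply/measurable_EFinP; exact: measurable_specification (@cylinder_local D z).
have : (\int[mu]_w `|(EFin \o specification E beta lambda D (cylinder D z)) w| = 0)%E.
  rewrite -mu0 (gmu D); last exact: measurable_cylinder.
  by apply: eq_integral => w _ /=; rewrite ger0_norm// specification_ge0.
move/(ae_eq_integral_abs _ measurableT mf) => [A [mA A0 sA]].
have : mu setT = 0.
  apply/eqP; rewrite -measure_le0 -A0; apply: le_measure; rewrite ?inE// => w _.
  apply: sA => /=/(_ I) [] /eqP; apply/negP; rewrite gt_eqF//.
  rewrite divr_gt0 ?partition_function_gt0// (bigD1 (restrict D z))//=.
  rewrite ltr_pwDl//; last first.
    by rewrite sumr_ge0// => b _; rewrite mulr_ge0// ltW// boltzmann_gt0.
  rewrite mulr_gt0 ?boltzmann_gt0// indicE mem_set// => i iD.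
  by rewrite -(splice_restrict z w iD).
by rewrite probability_setT => /eqP; rewrite onee_eq0.
Qed.

(** Probability of the pattern of [z] on [W] under the Gibbs specification in [W] with holes
    outside. *)
Definition hole_weight W z : R :=
  boltzmann E beta lambda W (splice (restrict W z) holes)
  / partition_function E beta lambda W holes.

Definition hole_boundary W D z :=
  forall i j, i \in W -> j \notin W -> E i j -> j \in D /\ z j = Hole.

(** Apply the DLR equation in [W]: on the cylinder over [D] every outer neighbour of [W] is a hole,
    so the conditional law inside [W] is the one with hole boundary. *)
Lemma gibbs_cylinder mu W D z z' : gibbs_measure E beta lambda mu ->
  [disjoint W & D]%fset -> hole_boundary W D z ->
  (mu (cylinder W z' `&` cylinder D z)
   = (hole_weight W z')%:E * mu (cylinder D z))%E.
Proof.
move=> gmu WD hb; have mD := measurable_cylinder D z.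
rewrite (gmu W); last by apply: measurableI => //; exact: measurable_cylinder.
have hw0 : 0 <= hole_weight W z'.
  by rewrite divr_ge0 ?(ltW (partition_function_gt0 _ _)) ?ltW ?boltzmann_gt0.
rewrite -[cylinder D z in RHS]setIT -integral_indic//.
rewrite -ge0_integralZl_EFin//; last first.
  by apply/measurable_EFinP; exact: measurable_indic.
apply: eq_integral => w _; rewrite -EFinM; congr _%:E.
(* Resampling inside [W] does not affect the event on [D], the two sets being disjoint. *)
have cDE (a : {ffun W -> spin}) : cylinder D z (splice a w) <-> cylinder D z w.
  by split=> h i iD; rewrite -h// splice_out//; move/fdisjointP_sym: WD; apply.
rewrite [in RHS]indicE; case: (boolP (w \in cylinder D z)) => [|nw]; last first.
  rewrite mulr0 /specification big1 ?mul0r// => a _.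
  rewrite indicE memNset ?mulr0// => -[_ /cDE wD].
  by rewrite mem_set in nw.
rewrite inE mulr1 => wD.
have bE (a : {ffun W -> spin}) : boltzmann E beta lambda W (splice a w) =
    boltzmann E beta lambda W (splice a holes).
  apply: boltzmann_agree => i iN; have [iW|iW] := boolP (i \in W).
    by rewrite !spliceE.
  have [j jW Eji] := nbhd_inv iN iW; have [iD zi] := hb _ _ jW iW Eji.
  by rewrite !splice_out// wD.
rewrite /specification /hole_weight; congr (_ / _); last first.
  by apply: eq_bigr => a _; exact: bE.
rewrite (bigD1 (restrict W z'))//= big1 ?addr0.
  rewrite bE indicE mem_set ?mulr1//; split; last exact/cDE.
  by move=> i iW; rewrite -(splice_restrict z' w iW).
move=> a /eqP az; rewrite indicE memNset ?mulr0// => -[h _]; apply: az.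
by apply: (@splice_agree _ _ _ w) => i iW; rewrite h.
Qed.

End Gibbs.

(** * The time-evolved measure *)

Section TimeEvolution.
Context {R : realType} {V : choiceType}.
Variables (E : rel V) (N : V -> {fset V}) (beta lambda t : R).
Hypothesis E_sym : symmetric E.
Hypothesis N_E : forall i j, (j \in N i) = E i j.
Hypothesis beta_ge0 : 0 <= beta.
Hypothesis lambda_gt0 : 0 < lambda.
Hypothesis t_ge0 : 0 <= t.
Variables mu nu : probability (Omega V) R.
Hypothesis gmu : gibbs_measure E beta lambda mu.
Variable K : R.-pker (Omega V) ~> (Omega V).
Hypothesis kerK : product_kernel t K.
Hypothesis nuE : forall A, measurable A -> nu A = (\int[mu]_w K w A)%E.
Implicit Types (S L W D : {fset V}) (w z : Omega V).

(** * Transition probabilities on finite sets of sites *)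

Lemma site_transition_ge0 s s' : 0 <= site_transition t s s'.
Proof.
have e1 : expR (- 2 * t) <= 1 by rewrite -expR0 ler_expR mulNr oppr_le0 mulr_ge0.
by rewrite !addr_ge0// mulr_ge0// mulr_ge0// ?subr_ge0// addr_ge0// expR_ge0.
Qed.

Lemma site_transition_diag s : 0 < site_transition t s s.
Proof.
have e0 : 0 < 2^-1 * (1 + expR (- 2 * t)) by rewrite mulr_gt0// addr_gt0// expR_gt0.
by case: s; rewrite /site_transition ?eqxx /= ?mulr1 ?mulr0 ?addr0 ?add0r.
Qed.

(** This lets a hole seen at time [t] be read as a hole at time 0. *)
Lemma site_transition_to_hole s : site_transition t s Hole = (s == Hole)%:R.
Proof. by case: s; rewrite /site_transition/= ?mulr0 ?addr0 ?add0r. Qed.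

Definition transition_weight S w z : R :=
  \prod_(i <- S) site_transition t (w i) (z i).

Lemma transition_weight_ge0 S w z : 0 <= transition_weight S w z.
Proof. by rewrite prodr_ge0// => i _; exact: site_transition_ge0. Qed.

Lemma transition_weight_agree S w w' z z' : agree S w w' -> agree S z z' ->
  transition_weight S w z = transition_weight S w' z'.
Proof.
move=> ww zz; rewrite /transition_weight big_seq [RHS]big_seq.
by apply: eq_bigr => i iS; rewrite ww// zz.
Qed.

Lemma transition_weight_holes S w z i : i \in S -> z i = Hole -> w i != Hole ->
  transition_weight S w z = 0.
Proof.
move=> iS zi /negbTE wi; rewrite /transition_weight (big_rem i)//=.
by rewrite zi site_transition_to_hole wi mul0r.
Qed.

Lemma transition_weightU W D w z : [disjoint W & D]%fset ->
  transition_weight (W `|` D)%fset w z =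
  transition_weight W w z * transition_weight D w z.
Proof.
move=> WD; rewrite /transition_weight -big_cat; apply: perm_big.
apply: uniq_perm => [//||i]; last by rewrite mem_cat in_fsetU.
rewrite cat_uniq !fset_uniq/= andbT; apply/hasPn => i iD.
by move/fdisjointP_sym: WD; apply.
Qed.

Lemma measurable_transition_weight S z :
  measurable_fun [set: Omega V] (fun w => (transition_weight S w z)%:E).
Proof.
apply/measurable_EFinP; apply: (@measurable_fun_local _ _ _ _ S) => w w' ww.
exact: transition_weight_agree.
Qed.

Lemma evolved_cylinder S z :
  nu (cylinder S z) = (\int[mu]_w (transition_weight S w z)%:E)%E.
Proof.
rewrite nuE; last exact: measurable_cylinder.
by apply: eq_integral => w _; rewrite kerK.
Qed.

Lemma evolved_cylinder_gt0 S z : (0 < nu (cylinder S z))%E.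
Proof.
rewrite evolved_cylinder; have mC := measurable_cylinder S z.
(* Keep only the initial configurations already equal to [z] on [S]; each spin has a positive
   probability of being unchanged at time [t]. *)
apply: (@lt_le_trans _ _ (\int[mu]_(w in cylinder S z) (transition_weight S z z)%:E)%E).
  rewrite integral_cst// mule_gt0//; last first.
    exact: (gibbs_cylinder_gt0 E_sym N_E lambda_gt0 _ _ gmu).
  by rewrite lte_fin prodr_gt0// => i _; exact: site_transition_diag.
rewrite (@eq_integral _ _ _ mu _ (fun w => (transition_weight S w z)%:E)); last first.
  move=> w; rewrite inE => wz; congr _%:E; apply: transition_weight_agree => //.
  by move=> i iS; rewrite wz.
apply: ge0_subset_integral => //; first exact: measurable_transition_weight.
by move=> w _; rewrite lee_fin transition_weight_ge0.
Qed.

(** Probability of the pattern of [z] on [W] when the Gibbs law in [W] with hole boundary is evolved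
    up to time [t]. *)
Definition evolved_weight W z : R :=
  \sum_(a : {ffun W -> spin})
    transition_weight W (splice a holes) z
    * hole_weight E beta lambda W (splice a holes).

(** Both integrals are split along the initial pattern on [D]. Patterns with holes around [W]
    decouple; the others have transition weight 0. *)
Lemma integral_cylinder_transition W D z z' :
  [disjoint W & D]%fset -> hole_boundary E W D z ->
  (\int[mu]_(w in cylinder W z') (transition_weight D w z)%:E
   = (hole_weight E beta lambda W z')%:E * nu (cylinder D z))%E.
Proof.
move=> WD hb; have mW := measurable_cylinder W z'.
have tw0 w : (0 <= (transition_weight D w z)%:E)%E.
  by rewrite lee_fin transition_weight_ge0.
have mtw := @measurable_transition_weight D z.
have const (B : set (Omega V)) (b : {ffun D -> spin}) : measurable B ->
    (\int[mu]_(w in B `&` cylinder D (splice b holes)) (transition_weight D w z)%:E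
     = (transition_weight D (splice b holes) z)%:E
       * mu (B `&` cylinder D (splice b holes)))%E.
  move=> mB; rewrite -integral_cst//; last first.
    by apply: measurableI => //; exact: measurable_cylinder.
  apply: eq_integral => w; rewrite inE => -[_ wb]; congr _%:E.
  exact: transition_weight_agree.
rewrite evolved_cylinder (ge0_integral_cylinder _ D mW mtw tw0).
rewrite (ge0_integral_cylinder _ D measurableT mtw tw0) ge0_sume_distrr; last first.
  by move=> b _; exact: integral_ge0.
apply: eq_bigr => b _; rewrite !const// setTI muleCA.
(* If b has a particle on the boundary of W, it cannot evolve into z. *)
have [hbb|nb] := pselect (hole_boundary E W D (splice b holes)).
  by rewrite (gibbs_cylinder E_sym N_E lambda_gt0 _ gmu).
suff -> : transition_weight D (splice b holes) z = 0 by rewrite !mul0e.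
apply: contra_notP nb => /eqP tw i j iW jW Eij; have [jD zj] := hb i j iW jW Eij.
split=> //; apply/eqP; apply: contraNT tw => bj; apply/eqP.
exact: transition_weight_holes bj.
Qed.

(** Sum over the initial pattern on [W]: the sites evolve independently, so the transition weight
    splits into a constant for [W] and a factor for [D], to which the decoupling at time 0
    applies. *)
Lemma evolved_cylinder_factor W D z :
  [disjoint W & D]%fset -> hole_boundary E W D z ->
  (nu (cylinder (W `|` D)%fset z) = (evolved_weight W z)%:E * nu (cylinder D z))%E.
Proof.
move=> WD hb; rewrite evolved_cylinder.
rewrite (ge0_integral_cylinder _ W measurableT); last 2 first.
- exact: measurable_transition_weight.
- by move=> w; rewrite lee_fin transition_weight_ge0.
rewrite /evolved_weight -sumEFin ge0_sume_distrl; last first.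
  move=> a _; rewrite lee_fin mulr_ge0 ?transition_weight_ge0//.
  by rewrite divr_ge0// ltW// ?boltzmann_gt0// partition_function_gt0.
apply: eq_bigr => a _; rewrite setTI EFinM -muleA -integral_cylinder_transition//.
rewrite -ge0_integralZl_EFin ?transition_weight_ge0//.
- apply: eq_integral => w; rewrite inE => wa; rewrite -EFinM transition_weightU//.
  by congr ((_ * _)%:E); exact: transition_weight_agree.
- exact: measurable_cylinder.
- by move=> w _; rewrite lee_fin transition_weight_ge0.
- apply: measurable_funTS; exact: measurable_transition_weight.
Qed.

(** If [w] has a hole in [S], the kernel keeps that hole with probability 1, so the event has mass
    0. *)
Lemma kernel_occupied w S : (K w (occupied S) <= (\1_(occupied S) w)%:E)%E.
Proof.
have mo : measurable (@occupied V S) := measurable_local (@occupied_local V S).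
rewrite indicE; have [_|] := boolP (w \in occupied S).
  by rewrite -(@prob_kernel _ _ _ _ _ K w); apply: le_measure; rewrite ?inE.
rewrite notin_setE => /existsNP[i /not_implyP[iS /negP]]; rewrite negbK => /eqP wi.
have KC : K w (cylinder [fset i]%fset holes) = 1%E.
  by rewrite kerK big_seq_fset1 wi site_transition_to_hole eqxx.
have -> : (0%R%:E = K w (~` cylinder [fset i]%fset holes))%E.
  have mC := measurable_cylinder [fset i]%fset (@holes V).
  rewrite -setTD measureD//; last first.
    by apply: (@le_lt_trans _ _ 1%E); rewrite ?ltry// -(@prob_kernel _ _ _ _ _ K w).
  rewrite setTI -[LHS](@subee _ 1%E)//; congr (_ - _)%E; last exact/esym.
  exact/esym/prob_kernel.
apply: le_measure; rewrite ?inE//.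
  by apply: measurableC; exact: measurable_cylinder.
move=> z oz; apply/existsNP; exists i; apply/not_implyP; rewrite in_fset1.
by split=> // zi; move: (oz _ iS); rewrite zi.
Qed.

Lemma evolved_occupied S :
  (nu (occupied S) <= ((2 * lambda) ^+ #|` S|)%:E)%E.
Proof.
have mo : measurable (@occupied V S) := measurable_local (@occupied_local V S).
apply: le_trans (gibbs_occupied E_sym N_E beta_ge0 lambda_gt0 S gmu).
rewrite nuE// -[X in (_ <= mu X)%E]setIT -integral_indic//.
apply: ge0_le_integral => //.
- exact: measurable_kernel.
- apply/measurable_EFinP; exact: measurable_indic.
- by move=> w _; exact: kernel_occupied.
Qed.


(** Unnormalized expectation of [f] under the evolved law in [W] with hole boundary, restricted to
    patterns agreeing with [z] on [U]; [f := cst 1] gives the normalization. *)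
Definition weighted_sum W U (f : Omega V -> R) z : R :=
  \sum_(a : {ffun W -> spin})
    f (splice a holes) * (\1_(cylinder U z) (splice a holes)
                          * evolved_weight W (splice a holes)).

Lemma weighted_sum_agree W U (f : Omega V -> R) z z' : agree U z z' ->
  weighted_sum W U f z = weighted_sum W U f z'.
Proof.
move=> zz; apply: eq_bigr => a _; rewrite !indicE.
congr (_ * ((nat_of_bool _)%:R * _)).
by apply/idP/idP; rewrite !inE => h i iU; rewrite h// zz.
Qed.

(** Split along the pattern on [W]: there [f] is constant, and each piece is either empty or a
    cylinder over [W] and [D], which factorizes. *)
Lemma integral_local_cylinder W D U (f : Omega V -> R) z :
  (forall w w', agree W w w' -> f w = f w') ->
  (U `<=` W)%fset -> [disjoint W & D]%fset -> hole_boundary E W D z ->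
  (\int[nu]_(w in cylinder (U `|` D)%fset z) (f w)%:E
   = (weighted_sum W U f z)%:E * nu (cylinder D z))%E.
Proof.
move=> floc UW WD hb; have mC S y := @measurable_cylinder V S y.
rewrite (integral_cylinder _ W (mC _ _)); last exact: measurable_fun_local floc.
(* Naming the finite probability as a real number allows the sum to be distributed in [R]. *)
have [r rE] : exists r, nu (cylinder D z) = r%:E.
  by exists (fine (nu (cylinder D z))); rewrite fineK// fin_num_measure.
rewrite rE -EFinM mulr_suml -sumEFin; apply: eq_bigr => a _.
set A := _ `&` _; have mA : measurable A by apply: measurableI; exact: mC.
rewrite (@eq_integral _ _ _ nu A (fun=> (f (splice a holes))%:E)); last first.
  by move=> w; rewrite inE => -[_ wa]; rewrite (floc _ _ wa).
rewrite integral_cst// -mulrA EFinM; congr (_ * _)%E.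
rewrite EFinM -rE indicE.
have [aU|aU] := boolP (splice a holes \in cylinder U z); last first.
  rewrite !mul0r mul0e (_ : A = set0) ?measure0//; apply/seteqP; split => // w [wU wa].
  move/negP: aU; apply; apply/mem_set => i iU.
  by rewrite -wa ?(fsubsetP UW)// wU// in_fsetU iU.
rewrite mul1r; rewrite inE in aU.
have az : agree D (splice a z) z.
  by move=> i iD; rewrite splice_out//; move/fdisjointP_sym: WD; apply.
have zh : agree W (splice a z) (splice a holes).
  by move=> i iW; rewrite !spliceE.
have AE : A = cylinder (W `|` D)%fset (splice a z).
  apply/seteqP; split => [w [wU wa] i|w wW].
    rewrite in_fsetU => /orP[iW|iD]; first by rewrite zh// wa.
    by rewrite az// wU// in_fsetU iD orbT.
  split=> i; last by move=> iW; rewrite -zh// wW// in_fsetU iW.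
  rewrite in_fsetU => /orP[iU|iD]; last by rewrite wW ?in_fsetU ?iD ?orbT// az.
  have iW := fsubsetP UW _ iU.
  by rewrite wW ?in_fsetU ?iW// zh// aU.
have hb' : hole_boundary E W D (splice a z).
  by move=> i j iW jW Eij; have [jD zj] := hb i j iW jW Eij; rewrite az.
rewrite AE; apply: etrans (evolved_cylinder_factor WD hb') _.
congr ((_)%:E * nu _)%E.
  apply: eq_bigr => b _; congr (_ * _).
  by apply: transition_weight_agree.
by apply/seteqP; split=> w h i iD; rewrite h// az.
Qed.

(** Numerator and denominator carry the same factor [nu (cylinder D z)], which is finite and
    positive and therefore cancels. *)
Lemma cond_expectation_local W D U (f : Omega V -> R) z :
  (forall w w', agree W w w' -> f w = f w') ->
  (U `<=` W)%fset -> [disjoint W & D]%fset -> hole_boundary E W D z ->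
  cond_expectation nu f (U `|` D)%fset z
  = weighted_sum W U f z / weighted_sum W U (cst 1) z.
Proof.
move=> floc UW WD hb; rewrite /cond_expectation /Rintegral.
rewrite (integral_local_cylinder floc)//.
have -> : nu (cylinder (U `|` D)%fset z)
    = ((weighted_sum W U (cst 1) z)%:E * nu (cylinder D z))%E.
  rewrite -integral_local_cylinder//= integral_cst ?mul1e//.
  exact: measurable_cylinder.
have := evolved_cylinder_gt0 D z.
have : nu (cylinder D z) \is a fin_num.
  by rewrite fin_num_measure//; exact: measurable_cylinder.
case: (nu (cylinder D z)) => // r _; rewrite lte_fin => r0.
by rewrite -!EFinM/= -mulf_div divff ?mulr1// gt_eqF.
Qed.

(** As [L] contains [W] and its neighbours, the patched configuration has the holes of [eta] around
    [W]. The resulting value involves neither [xi] nor [D]. *)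
Lemma finite_volume_expectation_local W L0 L D (f : Omega V -> R) eta xi :
  (forall w w', agree W w w' -> f w = f w') -> (L0 `<=` W)%fset ->
  (forall i j, i \in W -> j \notin W -> E i j -> eta j = Hole) ->
  (nbhd N W `<=` L)%fset -> (L `<=` D)%fset ->
  finite_volume_expectation nu f L0 L D eta xi
  = weighted_sum W (W `\` L0)%fset f eta
    / weighted_sum W (W `\` L0)%fset (cst 1) eta.
Proof.
move=> floc L0W hole NL LD.
have WL : (W `<=` L)%fset.
  by apply: fsubset_trans NL; apply/fsubsetP => i; exact: sub_nbhd.
rewrite /finite_volume_expectation.
have -> : (L `\` L0 `|` D `\` L = (W `\` L0) `|` (D `\` W))%fset.
  apply/fsetP => i; rewrite !inE.
  move: (fsubsetP L0W i) (fsubsetP WL i) (fsubsetP LD i) => /implyP + /implyP + /implyP.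
  by case: (i \in L0); case: (i \in W); case: (i \in L); case: (i \in D).
have WD : [disjoint W & D `\` W]%fset.
  by apply/fdisjointP => i iW; rewrite inE iW.
rewrite (cond_expectation_local floc) ?fsubsetDl//; last first.
  move=> i j iW jW Eij; have jL : j \in L.
    by apply: (fsubsetP NL); exact: (nbhdP N_E) iW Eij.
  split; first by rewrite inE jW (fsubsetP LD).
  by rewrite /patch_conf jL (hole i).
have pe : agree (W `\` L0)%fset (patch_conf L eta xi) eta.
  by move=> i; rewrite inE => /andP[_ iW]; rewrite /patch_conf (fsubsetP WL).
by rewrite !(weighted_sum_agree _ _ pe).
Qed.

(** Enclose both [L0] and the support [M] of [f] in [W]; the oscillation then vanishes for every [L]
    containing [nbhd N W]. *)
Lemma good_configuration eta :
  (forall M : {fset V}, exists W : {fset V}, (M `<=` W)%fset /\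
    forall i j, i \in W -> j \notin W -> E i j -> eta j = Hole) ->
  ~ bad_configuration nu eta.
Proof.
move=> fin [f [L0 [[M /measurable_wrt_local floc]]]].
apply/negP; rewrite -leNgt.
have [W [/fsubUsetP[L0W MW] hole]] := fin (L0 `|` M)%fset.
apply: (@le_trans _ _ (ereal_sup [set oscillation nu f L0 eta L |
    L in [set L | (nbhd N W `<=` L)%fset]])).
  by apply: ereal_inf_lbound; exists (nbhd N W).
apply: ge_ereal_sup => _ [L /= NL <-]; apply: ge_ereal_sup => _ [x1 [x2 [D [LD ->]]]].
have flocW w w' : agree W w w' -> f w = f w'.
  by move=> ww; apply: floc => i iM; rewrite ww// (fsubsetP MW).
by rewrite !(finite_volume_expectation_local _ flocW L0W hole NL LD) subrr normr0.
Qed.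

End TimeEvolution.

(** * Clusters of occupied sites *)

Lemma measure_bigsetU_le d (T : measurableType d) (R : realType)
    (mu : measure T R) (I : eqType) (s : seq I) (F : I -> set T) (c : R) :
  (forall i, measurable (F i)) -> (forall i, i \in s -> mu (F i) <= c%:E)%E ->
  (mu (\big[setU/set0]_(i <- s) F i) <= (c *+ size s)%:E)%E.
Proof.
move=> mF; elim: s => [|i s IHs] Fc; first by rewrite big_nil measure0.
rewrite big_cons/= mulrS EFinD.
apply: (@le_trans _ _ (mu (F i) + mu (\big[setU/set0]_(j <- s) F j))%E).
  by apply: measureU2 => //; apply: bigsetU_measurable.
apply: leeD; first by apply: Fc; rewrite mem_head.
by apply: IHs => j js; apply: Fc; rewrite in_cons js orbT.
Qed.

Section Walks.
Context {V : choiceType}.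
Variables (E : rel V) (N : V -> {fset V}) (d : nat).
Hypothesis N_E : forall i j, (j \in N i) = E i j.
Hypothesis N_card : forall i, (#|` N i| <= d.+1)%N.

(** The starting vertex is left out of the list, and backtracking is allowed, which keeps the count
    a plain product. *)
Fixpoint walks (n : nat) (v : V) : seq (seq V) :=
  if n is m.+1 then [seq j :: p | j <- N v, p <- walks m j] else [:: [::]].

Lemma walksP n v p : (p \in walks n v) = path E v p && (size p == n).
Proof.
elim: n v p => [|n IHn] v [|j p] //=; first by rewrite andbF.
  by apply/allpairsPdep => -[? [? []]].
apply/allpairsPdep/idP => [[i [q [iN qw [-> ->]]]]|/andP[/andP[vj jp] sp]].
  by rewrite eqSS -andbA -IHn qw andbT -N_E.
by exists j, p; split => //; rewrite ?N_E// IHn jp.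
Qed.

Lemma size_walks n v : (size (walks n v) <= d.+1 ^ n)%N.
Proof.
elim: n v => //= n IHn v; rewrite size_allpairs_dep sumnE big_map expnS.
apply: (@leq_trans (\sum_(i <- N v) d.+1 ^ n)); first exact: leq_sum.
by rewrite big_const_seq count_predT iter_addn_0 mulnC leq_mul2r N_card orbT.
Qed.

(** Only self-avoiding walks count, so that a walk of n steps occupies n + 1 distinct sites. *)
Definition occupied_walk (v : V) (p : seq V) : set (Omega V) :=
  if uniq (v :: p) then occupied [fset x in v :: p]%fset else set0.

Definition long_cluster (n : nat) (v : V) : set (Omega V) :=
  \big[setU/set0]_(p <- walks n v) occupied_walk v p.

Definition infinite_cluster (v : V) : set (Omega V) :=
  \bigcap_n long_cluster n v.

Definition cluster (eta : Omega V) (v : V) : set V :=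
  [set u | exists p, [/\ path E v p, last v p = u &
                         all (fun i => eta i != Hole) (v :: p)]].

(** If no occupied self-avoiding walk from [v] has n steps, every site of the cluster ends one of
    the finitely many shorter walks. *)
Lemma finite_cluster eta v : ~ infinite_cluster v eta -> finite_set (cluster eta v).
Proof.
move=> /existsNP[n /not_implyP[_ short]].
apply: (@sub_finite_set _ _
  [set last v p | p in [set` flatten [seq walks k v | k <- iota 0 n]]]); last first.
  exact/finite_image/finite_seq.
(* Erasing loops makes the walk self-avoiding without adding sites. *)
move=> u [p [vp <- occ]]; case/shortenP: vp occ => q vq uq sub /= /andP[v0 occ].
have occq : all (fun i => eta i != Hole) (v :: q).
  by rewrite /= v0; apply/allP => i /sub/(allP occ).
exists q => //=; apply/flattenP; exists (walks (size q) v); last first.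
  by rewrite walksP vq eqxx.
apply/mapP; exists (size q) => //; rewrite mem_iota add0n /= ltnNge.
(* A self-avoiding walk with at least n steps would yield a forbidden one by truncation. *)
apply: contra_notN short => nq; rewrite /long_cluster -bigcup_seq.
have tq : subseq (v :: take n q) (v :: q) by rewrite /= eqxx take_subseq.
exists (take n q) => /=.
  by rewrite walksP size_takel// eqxx take_path.
rewrite /occupied_walk (subseq_uniq tq)// => i; rewrite !inE/= -in_cons.
by move=> /(mem_subseq tq)/(allP occq).
Qed.

(** Take for [W] the set [M] with the clusters of all sites of [nbhd N M]: an occupied neighbour of
    [W] would extend one of these clusters, hence lie in [W]. *)
Lemma hole_enclosure eta :
  (forall v, ~ infinite_cluster v eta) ->
  forall M : {fset V}, exists W : {fset V}, (M `<=` W)%fset /\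
    forall i j, i \in W -> j \notin W -> E i j -> eta j = Hole.
Proof.
move=> fin M; pose A := [set` M] `|` \bigcup_(v in [set` nbhd N M]) cluster eta v.
have fA : finite_set A.
  rewrite finite_setU; split => //; apply: bigcup_finite => // v _.
  exact: finite_cluster.
exists (fset_set A); split.
  by apply/fsubsetP => i iM; rewrite in_fset_set// inE; left.
move=> i j; rewrite !in_fset_set// inE => iA; rewrite notin_setE => jA Eij.
apply/eqP; apply: contra_notT jA => jo; right.
case: iA => [iM|[v vM [p [vp lp occ]]]].
  by exists j; [exact: (nbhdP N_E) iM Eij|exists [::]; rewrite /= jo].
exists v => //; exists (rcons p j); rewrite rcons_path vp lp last_rcons; split=> //.
by rewrite -rcons_cons all_rcons jo.
Qed.

Lemma measurable_occupied_walk v p : measurable (occupied_walk v p).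
Proof.
rewrite /occupied_walk; case: ifP => _ //.
exact: measurable_local (@occupied_local V _).
Qed.

Lemma measurable_long_cluster n v : measurable (long_cluster n v).
Proof. by apply: bigsetU_measurable => p _; exact: measurable_occupied_walk. Qed.

(** * Absence of percolation at small density *)

Section Percolation.
Context {R : realType}.
Variables (nu : probability (Omega V) R) (x : R).
Hypothesis x_ge0 : 0 <= x.
Hypothesis x_small : x * d.+1%:R <= 2^-1.
Hypothesis nu_occupied : forall S, (nu (occupied S) <= (x ^+ #|` S|)%:E)%E.

(** Union bound: at most (d+1)^n walks, each occupied with probability at most x^(n+1). *)
Lemma measure_long_cluster n v : (nu (long_cluster n v) <= (2^-1 ^+ n)%:E)%E.
Proof.
apply: (@le_trans _ _ ((x ^+ n.+1) *+ size (walks n v))%:E).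
  apply: measure_bigsetU_le => [p|p]; first exact: measurable_occupied_walk.
  rewrite walksP => /andP[_ /eqP <-].
  rewrite /occupied_walk; case: ifP => vp; last first.
    by rewrite measure0 lee_fin exprn_ge0.
  apply: le_trans (nu_occupied _) _.
  by rewrite card_fseq undup_id.
(* This discards the extra factor [x] coming from the starting vertex. *)
have x1 : x <= 1.
  apply: (@le_trans _ _ (x * d.+1%:R)); first by rewrite ler_peMr// ler1n.
  by rewrite (le_trans x_small)// invf_le1// ler1n.
rewrite lee_fin; apply: (@le_trans _ _ (x ^+ n * (d.+1%:R ^+ n))).
  rewrite -mulr_natr; apply: ler_pM; rewrite ?exprn_ge0//.
    by rewrite exprSr ler_piMr// exprn_ge0.
  by rewrite -natrX ler_nat size_walks.
by rewrite -exprMn lerXn2r// nnegrE ?mulr_ge0// invr_ge0.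
Qed.

Lemma infinite_cluster_negligible v : nu.-negligible (infinite_cluster v).
Proof.
have mI : measurable (infinite_cluster v).
  by apply: bigcapT_measurable => n; exact: measurable_long_cluster.
apply/negligibleP => //; apply/eqP; rewrite -measure_le0; apply/lee_addgt0Pr => e e0.
rewrite add0e.
have /cvgrPdist_lt/(_ e e0)[n _ /(_ n (leqnn n))] :
    (fun n => 2^-1 ^+ n : R) @ \oo --> 0.
  by apply: cvg_expr; rewrite ger0_norm ?invf_lt1 ?ltr1n.
rewrite /= sub0r normrN ger0_norm ?exprn_ge0// => ne.
apply: (@le_trans _ _ (nu (long_cluster n v))).
  by apply: le_measure; rewrite ?inE//; [exact: measurable_long_cluster|move=> w; exact].
by apply: le_trans (measure_long_cluster n v) _; rewrite lee_fin ltW.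
Qed.

(** By connectedness each vertex ends a walk from a fixed [v0], so the union over vertices becomes a
    countable union of finite ones. *)
Lemma percolation_negligible : connected_graph E ->
  nu.-negligible [set eta | exists v, infinite_cluster v eta].
Proof.
move=> conn.
have [[v0]|noV] := pselect (exists v0 : V, True); last first.
  by apply: (negligibleS _ (negligible_set0 nu)) => eta [v]; case: noV; exists v.
move=> _.
apply: (@negligibleS _ _ _ _ (\bigcup_k \big[setU/set0]_(p <- walks k v0)
    infinite_cluster (last v0 p))).
  move=> eta [v vinf]; have [p vp lp] := conn v0 v; exists (size p) => //.
  by rewrite -bigcup_seq; exists p; rewrite /= ?walksP ?vp ?eqxx ?lp.
apply: negligible_bigcup => k; elim: (walks k v0) => [|p s IHs].
  by rewrite big_nil; exact: negligible_set0.
by rewrite big_cons; apply: negligibleU => //; exact: infinite_cluster_negligible.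
Qed.

End Percolation.
End Walks.

(** * The almost sure Gibbs property at small activity *)

Theorem theorem2p14 (R : realType) (d : nat) (beta : R) (hbeta : 0 < beta) :
  exists lambda_g : R, 0 < lambda_g /\
    forall (V : choiceType) (E : rel V), cayley_tree d E ->
    forall lambda : R, 0 < lambda -> lambda < lambda_g ->
    forall mu : probability (Omega V) R,
      intermediate_measure E beta lambda mu ->
    forall t : R, 0 < t ->
    forall mu_t : probability (Omega V) R, time_evolved t mu mu_t ->
      almost_surely_gibbs mu_t.
Proof.
(* Chosen so that x = 2 lambda satisfies x (d+1) <= 1/2. *)
exists (4 * d.+1%:R)^-1; split; first by rewrite invr_gt0 mulr_gt0.
move=> V E [[E_sym _] conn _ deg _] lambda lambda_gt0 lambda_lt mu [gmu _ _ _].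
move=> t t_gt0 nu [K kerK nuE].
have fin i : finite_set [set j | E i j] by apply/finite_setP; exists d.+1.
pose N i := fset_set [set j | E i j].
have N_E i j : (j \in N i) = E i j.
  by rewrite in_fset_set//; apply/idP/idP; rewrite inE.
have N_card i : (#|` N i| <= d.+1)%N by rewrite (card_fset_set (deg i)).
have beta_ge0 := ltW hbeta; have t_ge0 := ltW t_gt0.
have x_ge0 : 0 <= 2 * lambda by rewrite mulr_ge0// ltW.
have x_small : 2 * lambda * d.+1%:R <= 2^-1.
  have d0 : (0 : R) < d.+1%:R by [].
  have : lambda * (4 * d.+1%:R) < 1.
    by rewrite -ltr_pdivlMr ?mulr_gt0// div1r.
  rewrite -(ler_pM2l (_ : 0 < 2)) // divff// => h.
  by apply: le_trans (ltW h); rewrite !mulrA -natrM [lambda * 4]mulrC.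
apply: negligibleS (percolation_negligible N_E N_card x_ge0 x_small
  (evolved_occupied E_sym N_E beta_ge0 lambda_gt0 gmu kerK nuE) conn).
move=> eta bad; apply: contrapT => noinf.
apply: (good_configuration E_sym N_E lambda_gt0 t_ge0 gmu kerK nuE _ bad).
by apply: (hole_enclosure N_E) => v inf; apply: noinf; exists v.
Qed.
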